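(* Let $P$ be a GSOS language in $\mathsf{iocos}$-format all of whose rules have as target either a variable or a term of the form $g(z_1,\dots,z_m)$ with $g\in\Sigma$ and variables $z_j$. For each term $t$ (a variable or a term $f(x_1,\dots,x_n)$ of this form), each formula $\varphi\in\mathcal L_{\mathsf{iocos}}$ and each closed substitution $\sigma$ (mapping variables to states), $\sigma(t)\models\varphi$ if and only if there exists $\psi\in t^{-1}(\varphi)$ such that $\sigma(x)\models\psi(x)$ for all $x\in var(t)$.
   Context: Actions: disjoint finite sets $I$ (inputs $a?$) and $O$ (outputs $a!$, incl. $\delta!$), $L=I\cup O$. GSOS rules: $\dfrac{\{x_i\xrightarrow{a_{ij}}y_{ij}\}\cup\{x_i\not\xrightarrow{b_{ik}}\}}{f(x_1,\dots,x_n)\xrightarrow{a}C}$ with all $x_i,y_{ij}$ distinct variables, $C$ a term over the $x_i,y_{ij}$; positive (negative) trigger for $x_i$ = $\{a_{ij}\}_j$ ($\{b_{ik}\}_k$). A GSOS language (finite signature $\Sigma$, finite rule set) induces transitions on terms built from LTS states: $f(\vec p)\xrightarrow{a}C[\vec p,\vec q]$ iff some $f$-rule has $p_i\xrightarrow{a_{ij}}q_{ij}$ and $p_i\not\xrightarrow{b_{ik}}$ for all $i,j,k$. $\mathsf{iocos}$-format: (1) input-emitting rules have only output labels in negative premises and only input labels in positive premises; (2) for each input $a?$ and $f$-rules $r=H/f(\vec x)\xrightarrow{a?}t$, $r'=H'/f(\vec x)\xrightarrow{a?}t'$ there is an $f$-rule $r''=H''/f(\vec x)\xrightarrow{a?}t'$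 whose positive and negative triggers for each $x_i$ are included in those of $r$, and such that $x_i\xrightarrow{b?}z\in H''$ with $z$ in $t'$ implies $x_i\xrightarrow{b?}z\in H'$; (3) output-emitting rules have only input labels in negative premises and only output labels in positive premises. $\mathcal L_{\mathsf{iocos}}$: formulae built from $\langle\!\langle a?\rangle\!\rangle\phi$, $\langle a!\rangle\phi$ and finite conjunctions/disjunctions $\bigwedge_{i\in J}\phi_i,\bigvee_{i\in J}\phi_i$ (empty conjunction $=\mathrm{tt}$, empty disjunction $=\mathrm{ff}$); $p\models\langle a!\rangle\phi$ iff some $a!$-successor satisfies $\phi$; $p\models\langle\!\langle a?\rangle\!\rangle\phi$ iff $p$ has no $a?$-transition or some $a?$-successor satisfies $\phi$. Ruloids (''rules for $t$''): for a variable $x$, the rules $x\xrightarrow{a}x'/x\xrightarrow{a}x'$ ($a\in L$); for $t=f(\dots)$, the $f$-defining rules of $P$ with $t$ as source. $R(t,a?)$ = set of rules for $t$ of the form $H/t\xrightarrow{a?}u$; $H_r$ = premises of $r$; $\chi(t,a?)$ = set of functions $\eta$ choosing $\eta(r)\in H_r$ for each $r\in R(t,a?)$. $\mathsf{neg}(x\not\xrightarrow{b!},x)=\langle b!\rangle\mathrm{tt}$, $\mathsf{neg}(x\xrightarrow{b?}x',x)=\langle\!\langle b?\rangle\!\rangle\mathrm{ff}$, and $\mathsf{neg}(\gamma,x)=\mathrm{tt}$ if the premise $\gamma$ has left-hand variable $y\ne x$. $var(u)$ = variables of $u$. The decomposition $t^{-1}(\varphi)$ is a set of maps $\psi:\mathsf{Var}\to\mathcal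 L_{\mathsf{iocos}}$ defined by: (i) $t^{-1}(\langle\!\langle a?\rangle\!\rangle\varphi)=t^{-1}_\chi\cup t^{-1}_R$, where $t^{-1}_\chi$ consists of the $\psi_\eta$, $\eta\in\chi(t,a?)$, with $\psi_\eta(x)=\bigwedge_{r\in R(t,a?)}\mathsf{neg}(\eta(r),x)$, and $\psi\in t^{-1}_R$ iff there are $r=H/t\xrightarrow{a?}u\in R(t,a?)$ and $\psi'\in u^{-1}(\varphi)$ with $\psi(x)=\bigwedge_{x\xrightarrow{b?}y\in H,\,y\in var(u)}\langle\!\langle b?\rangle\!\rangle\psi'(y)\wedge\psi'(x)$ if $x\in var(u)$ and the same without the conjunct $\psi'(x)$ otherwise; (ii) $\psi\in t^{-1}(\langle a!\rangle\varphi)$ iff there are a rule $H/t\xrightarrow{a!}u$ and $\psi'\in u^{-1}(\varphi)$ with $\psi(x)=\bigwedge_{x\xrightarrow{b!}y\in H,\,y\in var(u)}\langle b!\rangle\psi'(y)\wedge\bigwedge_{x\not\xrightarrow{c?}\in H}\langle\!\langle c?\rangle\!\rangle\mathrm{ff}\wedge\psi'(x)$ if $x\in var(u)$ and the same without $\psi'(x)$ otherwise; (iii) $t^{-1}(\bigvee_{i\in J}\varphi_i)=\bigcup_{i\in J}t^{-1}(\varphi_i)$; (iv) $\psi\in t^{-1}(\bigwedge_{i\in J}\varphi_i)$ iff there are $\psi_i\in t^{-1}(\varphi_i)$ ($i\in J$) with $\psi(x)=\bigwedge_{i\in J}\psi_i(x)$ for all $x$.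
   Formalization: In clause (ii), a premise x –b!→ y of H with y not in var(u) contributes the conjunct ⟨b!⟩tt instead of being dropped; as written the claim fails for the rule x –b!→ y / f(x) –a!→ x with φ = ⟨a!⟩tt. *)

(* Defs.v *)
From Stdlib Require List.
From HB Require Import structures.
From mathcomp Require Import all_boot.

Set Implicit Arguments.
Unset Strict Implicit.
Unset Printing Implicit Defensive.

Record actions := Actions {
  inputs : finType;
  outputs : finType;
  quiescence : outputs  (* delta! *)
}.

(* [inl a] is the input a?, [inr a] is the output a!. *)
Definition label (A : actions) : finType := (inputs A + outputs A)%type.

Definition is_input (A : actions) (a : label A) : bool :=
  if a is inl _ then true else false.

Definition is_output (A : actions) (a : label A) : bool := ~~ is_input a.

Record lts (A : actions) := LTS {
  state : Type;
  trans : state -> label A -> state -> Prop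
}.

Inductive formula (A : actions) : Type :=
| DiaIn of inputs A & formula A              (* <<a?>> phi *)
| DiaOut of outputs A & formula A            (* <a!> phi *)
| Conj (n : nat) of 'I_n -> formula A
| Disj (n : nat) of 'I_n -> formula A.

Fixpoint sat (A : actions) (S : lts A) (p : state S) (phi : formula A) : Prop :=
  match phi with
  | DiaIn a phi =>
      (forall q, ~ trans p (inl a) q) \/
      (exists2 q, trans p (inl a) q & sat q phi)
  | DiaOut a phi => exists2 q, trans p (inr a) q & sat q phi
  | Conj _ F => forall i, sat p (F i)
  | Disj _ F => exists i, sat p (F i)
  end.

Definition conj_seq (A : actions) (s : seq (formula A)) : formula A :=
  Conj (tnth (in_tuple s)).

Definition disj_seq (A : actions) (s : seq (formula A)) : formula A :=
  Disj (tnth (in_tuple s)).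

Definition ftt (A : actions) : formula A := conj_seq [::].

Definition fff (A : actions) : formula A := disj_seq [::].

Record signature := Signature {
  op : finType;
  arity : op -> nat
}.

(* The leaves [Var v] are variables, the formal variables of a rule, or the
   states of an LTS, depending on the choice of [V]. *)
Inductive term (Sg : signature) (V : Type) : Type :=
| Var of V
| App (f : op Sg) of 'I_(arity f) -> term Sg V.

Arguments Var {Sg V} _.

Fixpoint subst (Sg : signature) (V W : Type) (s : V -> term Sg W)
    (t : term Sg V) : term Sg W :=
  match t with
  | Var v => s v
  | App f ts => App (fun i => subst s (ts i))
  end.

Fixpoint vars (Sg : signature) (V : Type) (t : term Sg V) : seq V :=
  match t with
  | Var v => [:: v]
  | App f ts => flatten [seq vars (ts i) | i <- enum 'I_(arity f)]
  end.

Definition as_var (Sg : signature) (V : Type) (t : term Sg V) : option V :=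
  if t is Var v then Some v else None.

(* A variable, or an operator applied to (not necessarily distinct) variables. *)
Definition flat (Sg : signature) (V : Type) (t : term Sg V) : bool :=
  if t is App f ts then [forall i, isSome (as_var (ts i))] else true.

(* [X] is the type of the variables tested by the premises: [(x, a, y)] in
   [pos] is the premise x --a--> y, and [(x, b)] in [neg] is the premise
   x -/-b-->. The source of a rule is left implicit. *)
Record rule (A : actions) (Sg : signature) (X V : Type) := Rule {
  pos : seq (X * label A * nat);
  neg : seq (X * label A);
  act : label A;
  target : term Sg V
}.

(* All the rules for [f] have the source f(x_0, ..., x_(n-1)); the variable x_i
   is represented by its index [i], and [inl i], [inr y] are the occurrences of
   x_i and of the variable y in the target. *)
Definition gsos_rule (A : actions) (Sg : signature) (f : op Sg) :=
  rule A Sg 'I_(arity f) ('I_(arity f) + nat)%type.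

Definition gsos_wf (A : actions) (Sg : signature) (f : op Sg)
    (r : gsos_rule A f) : Prop :=
  uniq [seq p.2 | p <- pos r] /\
  (forall y, inr y \in vars (target r) -> y \in [seq p.2 | p <- pos r]).

Record gsos_language (A : actions) (Sg : signature) := GSOSLanguage {
  rules : forall f : op Sg, seq (gsos_rule A f);
  rules_wf : forall f (r : gsos_rule A f), List.In r (rules f) -> gsos_wf r
}.

Definition args_subst (Sg : signature) (n : nat) (W : Type)
    (ps : 'I_n -> term Sg W) (q : nat -> term Sg W) (v : 'I_n + nat) :
    term Sg W :=
  match v with inl i => ps i | inr y => q y end.

(* The negative premises rule out an inductive definition; recursion on the
   source term gives the unique transition relation that agrees with the rules. *)
Fixpoint step (A : actions) (Sg : signature) (P : gsos_language A Sg)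
    (S : lts A) (t : term Sg (state S)) (a : label A)
    (t' : term Sg (state S)) : Prop :=
  match t with
  | Var s => exists2 s', trans s a s' & t' = Var s'
  | App f ps =>
      exists r : gsos_rule A f, exists q : nat -> term Sg (state S),
        [/\ List.In r (rules P f) /\ act r = a,
            forall i b y, (i, b, y) \in pos r -> step P (ps i) b (q y),
            forall i b, (i, b) \in neg r -> forall p', ~ step P (ps i) b p'
          & t' = subst (args_subst ps q) (target r)]
  end.

Definition induced (A : actions) (Sg : signature) (P : gsos_language A Sg)
    (S : lts A) : lts A := LTS (@step A Sg P S).

Definition pos_trigger (A : actions) (Sg : signature) (f : op Sg)
    (r : gsos_rule A f) (i : 'I_(arity f)) : {set label A} :=
  [set a | (i, a) \in [seq p.1 | p <- pos r]].

Definition neg_trigger (A : actions) (Sg : signature) (f : op Sg)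
    (r : gsos_rule A f) (i : 'I_(arity f)) : {set label A} :=
  [set a | (i, a) \in neg r].

Definition iocos_input_premises (A : actions) (Sg : signature)
    (P : gsos_language A Sg) : Prop :=
  forall f (r : gsos_rule A f), List.In r (rules P f) -> is_input (act r) ->
    (forall i b, (i, b) \in neg r -> is_output b) /\
    (forall i b y, (i, b, y) \in pos r -> is_input b).

Definition iocos_input_mixing (A : actions) (Sg : signature)
    (P : gsos_language A Sg) : Prop :=
  forall (a : inputs A) f (r r' : gsos_rule A f),
    List.In r (rules P f) -> act r = inl a ->
    List.In r' (rules P f) -> act r' = inl a ->
    exists r'' : gsos_rule A f,
      [/\ [/\ List.In r'' (rules P f), act r'' = inl a & target r'' = target r'],
          forall i, pos_trigger r'' i \subset pos_trigger r i,
          forall i, neg_trigger r'' i \subset neg_trigger r i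
        & forall i (b : inputs A) z, (i, inl b, z) \in pos r'' ->
            inr z \in vars (target r') -> (i, inl b, z) \in pos r'].

Definition iocos_output_premises (A : actions) (Sg : signature)
    (P : gsos_language A Sg) : Prop :=
  forall f (r : gsos_rule A f), List.In r (rules P f) -> is_output (act r) ->
    (forall i b, (i, b) \in neg r -> is_input b) /\
    (forall i b y, (i, b, y) \in pos r -> is_output b).

Definition iocos_format (A : actions) (Sg : signature)
    (P : gsos_language A Sg) : Prop :=
  [/\ iocos_input_premises P, iocos_input_mixing P & iocos_output_premises P].

Definition var := nat.

Definition ruloid (A : actions) (Sg : signature) := rule A Sg var var.

(* Rules are taken up to renaming of the y's: [fresh t] is an injective renaming
   of them away from the variables of [t]. *)
Definition fresh (Sg : signature) (t : term Sg var) (y : nat) : var :=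
  (\max_(x <- vars t) x).+1 + y.

Definition instantiate (A : actions) (Sg : signature) (f : op Sg)
    (zs : 'I_(arity f) -> var) (ys : nat -> var) (r : gsos_rule A f) :
    ruloid A Sg :=
  Rule [seq (zs p.1.1, p.1.2, ys p.2) | p <- pos r]
       [seq (zs p.1, p.2) | p <- neg r]
       (act r)
       (subst (args_subst (fun i => Var (zs i)) (fun y => Var (ys y)))
          (target r)).

(* The rules with source t; only meant for flat t. The empty list for other terms
   is a default value. *)
Definition ruloids (A : actions) (Sg : signature) (P : gsos_language A Sg)
    (t : term Sg var) : seq (ruloid A Sg) :=
  match t with
  | Var x =>
      [seq Rule [:: (x, a, fresh t 0)] [::] a (Var (fresh t 0))
         | a <- enum (label A)]
  | App f ts =>
      if flat t then
        [seq instantiate (fun i => odflt 0 (as_var (ts i))) (fresh t) r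
           | r <- rules P f]
      else [::]
  end.

(* The set R(t, a); t is the implicit source of its elements. *)
Definition ruloids_for (A : actions) (Sg : signature) (P : gsos_language A Sg)
    (t : term Sg var) (a : label A) : seq (ruloid A Sg) :=
  [seq r <- ruloids P t | act r == a].

Definition premise (A : actions) : Type :=
  (var * label A * var + var * label A)%type.

Definition in_premises (A : actions) (Sg : signature) (r : ruloid A Sg)
    (g : premise A) : bool :=
  match g with inl p => p \in pos r | inr n => n \in neg r end.

(* The last two cases, x --b!--> y and x -/-b?-->, do not occur in the
   input-emitting rules of a language in iocos-format. *)
Definition negate (A : actions) (g : premise A) (x : var) : formula A :=
  match g with
  | inr (y, inr b) => if y == x then DiaOut b (ftt A) else ftt A
  | inl (y, inl b, _) => if y == x then DiaIn b (fff A) else ftt A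
  | inl (y, inr _, _) => if y == x then fff A else ftt A
  | inr (y, inl _) => if y == x then fff A else ftt A
  end.

(* The set chi(t, a?). *)
Definition chooser (A : actions) (Sg : signature) (P : gsos_language A Sg)
    (t : term Sg var) (a : inputs A) (eta : ruloid A Sg -> premise A) : Prop :=
  forall r, List.In r (ruloids_for P t (inl a)) -> in_premises r (eta r).

Definition decomp_chi (A : actions) (Sg : signature) (P : gsos_language A Sg)
    (t : term Sg var) (a : inputs A) (psi : var -> formula A) : Prop :=
  exists2 eta, chooser P t a eta &
    forall x, psi x =
      conj_seq [seq negate (eta r) x | r <- ruloids_for P t (inl a)].

Definition target_conjunct (A : actions) (Sg : signature) (r : ruloid A Sg)
    (psi' : var -> formula A) (x : var) : seq (formula A) :=
  if x \in vars (target r) then [:: psi' x] else [::].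

Definition pull_in (A : actions) (Sg : signature) (r : ruloid A Sg)
    (psi' : var -> formula A) (x : var) : formula A :=
  conj_seq
    (pmap (fun p : var * label A * var =>
       if p is (z, inl b, y) then
         if (z == x) && (y \in vars (target r))
         then Some (DiaIn b (psi' y)) else None
       else None) (pos r)
     ++ target_conjunct r psi' x).

(* A positive premise x --b!--> y has to hold even when y does not occur in the
   target; nothing is then required of y, and the premise contributes <b!>tt.
   Dropping it would be wrong: with the single rule x --b!--> y / f(x) --a!--> x,
   the decomposition of <a!>tt would accept an x without b!-transitions.
   In [pull_in] the corresponding premises can be dropped: <<b?>> does not demand
   a transition, and [iocos_input_mixing] makes up for it. *)
Definition pull_out (A : actions) (Sg : signature) (r : ruloid A Sg)
    (psi' : var -> formula A) (x : var) : formula A :=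
  conj_seq
    (pmap (fun p : var * label A * var =>
       if p is (z, inr b, y) then
         if z == x
         then Some (DiaOut b (if y \in vars (target r) then psi' y else ftt A))
         else None
       else None) (pos r)
     ++ pmap (fun n : var * label A =>
       if n is (z, inl c) then
         if z == x then Some (DiaIn c (fff A)) else None
       else None) (neg r)
     ++ target_conjunct r psi' x).

(* [decomp P phi t psi] is the membership of psi in t^-1(phi). *)
Fixpoint decomp (A : actions) (Sg : signature) (P : gsos_language A Sg)
    (phi : formula A) (t : term Sg var) (psi : var -> formula A) : Prop :=
  match phi with
  | DiaIn a phi =>
      decomp_chi P t a psi \/
      exists r psi', [/\ List.In r (ruloids_for P t (inl a)),
        decomp P phi (target r) psi' & forall x, psi x = pull_in r psi' x]
  | DiaOut a phi =>
      exists r psi', [/\ List.In r (ruloids_for P t (inr a)),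
        decomp P phi (target r) psi' & forall x, psi x = pull_out r psi' x]
  | Disj n F => exists i, decomp P (F i) t psi
  | Conj n F =>
      exists2 Psi : 'I_n -> var -> formula A,
        forall i, decomp P (F i) t (Psi i) &
        forall x, psi x = Conj (fun i => Psi i x)
  end.

(* Main.v *)
(** By induction on the formula, for all flat terms and substitutions.  A
    transition of [subst sigma t] is the same thing as a ruloid of [t] together
    with an extension of [sigma] to the fresh variables that validates its
    premises.  If [<<a?>> phi] holds for lack of an a?-transition, then each
    ruloid has a failing premise, and choosing one per ruloid gives psi_eta.
    Conversely, a psi obtained from a ruloid [r'] need not make [r'] fire; but if
    some ruloid [r] fires, [iocos_input_mixing] provides a ruloid with the target
    of [r'] whose triggers are enabled because those of [r] are. *)
Require Import Defs.
From Stdlib Require List.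
From Stdlib Require Import FunctionalExtensionality Classical IndefiniteDescription.
From mathcomp Require Import all_boot.

Set Implicit Arguments.
Unset Strict Implicit.
Unset Printing Implicit Defensive.

(** * Membership in sequences *)

(** Rules and formulae contain functions on ordinals and carry no [eqType] structure, so membership
    among them is [List.In]; premises and variables use [\in]. *)
Lemma mem_In (T : eqType) (s : seq T) x : List.In x s <-> x \in s.
Proof.
elim: s => [|y s IHs] //=; rewrite inE.
split=> [[->|/IHs ->]|/orP[/eqP->|/IHs]]; rewrite ?eqxx ?orbT //; by [left|right].
Qed.

Lemma In_map (T U : Type) (f : T -> U) s u :
  List.In u (map f s) <-> exists2 x, List.In x s & f x = u.
Proof.
elim: s => [|y s IHs] /=; first by split=> // -[].
split=> [[<-|fsu]|[x [<-|sx] fx]].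
- by exists y => //; left.
- by have [x sx fx] := IHs.1 fsu; exists x => //; right.
- by left.
- by right; apply/IHs; exists x.
Qed.

Lemma In_filter (T : Type) (a : pred T) s x :
  List.In x (filter a s) <-> List.In x s /\ a x.
Proof.
elim: s => [|y s IHs] /=; first by split=> // -[].
case ay: (a y) => /=; split.
- by case=> [<-|/IHs[]]; split=> //; [left|right].
- by case=> -[->|sx] ax; [left|right; apply/IHs].
- by case/IHs=> sx ax; split=> //; right.
- by case=> -[yx|sx] ax; [rewrite -yx ay in ax|apply/IHs].
Qed.

Lemma In_pmap (T U : Type) (f : T -> option U) s u :
  List.In u (pmap f s) <-> exists2 x, List.In x s & f x = Some u.
Proof.
elim: s => [|y s IHs] /=; first by split=> // -[].
have skip : (exists2 x, List.In x s & f x = Some u) ->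
    exists2 x, y = x \/ List.In x s & f x = Some u.
  by case=> x sx fx; exists x => //; right.
case fy: (f y) => [v|] /=; split.
- by case=> [<-|/IHs/skip//]; exists y => //; left.
- by case=> x [<-|sx] fx; [left; move: fx; rewrite fy => -[]|right; apply/IHs; exists x].
- by move/IHs/skip.
- by case=> x [<-|sx] fx; [rewrite fy in fx|apply/IHs; exists x].
Qed.

Lemma In_cat (T : Type) (s1 s2 : seq T) x :
  List.In x (s1 ++ s2) <-> List.In x s1 \/ List.In x s2.
Proof. exact: List.in_app_iff. Qed.

(** With [f] the projection to the right-hand variable, this makes a premise of a well-formed rule
    determined by that variable. *)
Lemma uniq_map_inj (T U : eqType) (f : T -> U) (s : seq T) x y :
  uniq (map f s) -> x \in s -> y \in s -> f x = f y -> x = y.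
Proof.
elim: s => //= z s IHs /andP[Nfz Us]; rewrite !inE.
case/predU1P=> [->|sx] /predU1P[->|sy] // fxy; last exact: IHs.
  by rewrite fxy map_f in Nfz.
by rewrite -fxy map_f in Nfz.
Qed.

(** * Variables and substitution in terms *)

Section Terms.

Variable Sg : signature.

Lemma mem_vars_App (V : eqType) (f : op Sg) (ts : 'I_(arity f) -> term Sg V) v :
  v \in vars (App ts) <-> exists i, v \in vars (ts i).
Proof.
split=> [/flatten_mapP[i _ tsi]|[i tsi]]; first by exists i.
by apply/flatten_mapP; exists i; rewrite ?mem_enum.
Qed.

Lemma mem_vars_subst (V W : eqType) (s : V -> term Sg W) t w :
  w \in vars (subst s t) <-> exists2 v, v \in vars t & w \in vars (s v).
Proof.
elim: t => [v|f ts IHt].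
  split=> [sv|[u]]; first by exists v; rewrite ?inE.
  by rewrite inE => /eqP->.
split=> [/mem_vars_App[i /IHt[v tv sv]]|[v /mem_vars_App[i tv] sv]].
  by exists v => //; apply/mem_vars_App; exists i.
by apply/mem_vars_App; exists i; apply/IHt; exists v.
Qed.

Lemma subst_subst (U V W : Type) (s1 : U -> term Sg V) (s2 : V -> term Sg W) t :
  subst s2 (subst s1 t) = subst (fun u => subst s2 (s1 u)) t.
Proof.
elim: t => [v|f ts IHt] //=.
by congr App; apply: functional_extensionality => i; apply: IHt.
Qed.

(** Presents the arguments of a flat term as a function into variables, the shape on which
    [instantiate] acts. *)
Lemma flat_App (V : Type) (f : op Sg) (ts : 'I_(arity f) -> term Sg V) :
  flat (App ts) <-> exists zs, ts = fun i => Var (zs i).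
Proof.
split=> [/forallP ts_var|[zs ->]]; last exact/forallP.
have /fin_all_exists[zs zsE] : forall i, exists z, ts i = Var z.
  by move=> i; move: (ts_var i); case: (ts i) => // z _; exists z.
by exists zs; apply: functional_extensionality.
Qed.

Lemma flat_subst (V W : Type) (s : V -> term Sg W) t :
  (forall v, exists w, s v = Var w) -> flat t -> flat (subst s t).
Proof.
move=> s_var; case: t => [v _|f ts /forallP ts_var] /=.
  by case: (s_var v) => w ->.
apply/forallP=> i; move: (ts_var i); case: (ts i) => //= v _.
by case: (s_var v) => w ->.
Qed.

Lemma fresh_notin (t : term Sg var) y : fresh t y \notin vars t.
Proof.
apply/negP=> ty; have := @leq_bigmax_seq _ (vars t) xpredT id _ ty isT.
by rewrite /fresh leqNgt addSn ltnS leq_addr.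
Qed.

Lemma fresh_inj (t : term Sg var) : injective (fresh t).
Proof. by move=> y1 y2 /addnI. Qed.

End Terms.

(** * Satisfaction of conjunctions and of the formulae of a decomposition *)

Section Satisfaction.

Variables (A : actions) (S : lts A).
Implicit Type p : state S.

Lemma sat_conj_seq p s :
  sat p (conj_seq s) <-> forall phi, List.In phi s -> sat p phi.
Proof.
have In_nth : forall (s : seq (formula A)) phi i, i < size s -> List.In (nth phi s i) s.
  by elim=> //= psi s' IHs phi [|i] lti; [left|right; apply: IHs].
have nth_In : forall (s : seq (formula A)) phi,
    List.In phi s -> exists2 i, i < size s & nth phi s i = phi.
  elim=> //= psi s' IHs phi [->|/IHs[i lti <-]]; first by exists 0.
  by exists i.+1 => //=; apply: set_nth_default.
split=> [sat_s phi /nth_In[i lti phiE]|sat_s i].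
  by have := sat_s (Ordinal lti); rewrite (tnth_nth phi) /= phiE.
by apply: sat_s; apply: In_nth.
Qed.

Lemma sat_ftt p : sat p (ftt A).
Proof. exact/sat_conj_seq. Qed.

Lemma not_sat_fff p : ~ sat p (fff A).
Proof. by case=> -[]. Qed.

Lemma sat_DiaIn_fff p a :
  sat p (DiaIn a (fff A)) <-> forall q, ~ trans p (inl a) q.
Proof. by split=> [[//|[q _ /not_sat_fff]]|]; last by left. Qed.

Lemma sat_DiaOut_ftt p a :
  sat p (DiaOut a (ftt A)) <-> exists q, trans p (inr a) q.
Proof.
by split=> [[q pq _]|[q pq]]; exists q => //; apply: sat_ftt.
Qed.

Variable Sg : signature.
Implicit Type r : ruloid A Sg.

Lemma In_target_conjunct r (psi : var -> formula A) x phi :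
  List.In phi (target_conjunct r psi x) <-> x \in vars (target r) /\ psi x = phi.
Proof.
rewrite /target_conjunct; case: ifP => _ /=; last by split=> // -[].
by split=> [[]|[_]]; [|by []|left].
Qed.

(** Separates the demands made by the premises that [pmap] keeps from the demand made by an
    occurrence of [x] in the target. *)
Lemma sat_pull_in p r (psi : var -> formula A) x :
  sat p (pull_in r psi x) <->
  (forall b y, (x, inl b, y) \in pos r -> y \in vars (target r) ->
     sat p (DiaIn b (psi y))) /\
  (x \in vars (target r) -> sat p (psi x)).
Proof.
split=> [/sat_conj_seq sat_x|[sat_pos sat_target]].
  split=> [b y ry uy|ux]; apply: sat_x; apply/In_cat; last first.
    by right; apply/In_target_conjunct.
  left; apply/In_pmap; exists (x, inl b, y); first exact/mem_In.
  by rewrite eqxx uy.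
apply/sat_conj_seq=> phi /In_cat[/In_pmap[]|/In_target_conjunct[ux <-]]; last first.
  exact: sat_target.
move=> [[z [b|//]] y] /mem_In ry; case: andP => // -[/eqP zx uy] [<-].
by apply: sat_pos => //; rewrite -zx.
Qed.

Lemma sat_pull_out p r (psi : var -> formula A) x :
  sat p (pull_out r psi x) <->
  [/\ forall b y, (x, inr b, y) \in pos r ->
        sat p (DiaOut b (if y \in vars (target r) then psi y else ftt A)),
      forall c, (x, inl c) \in neg r -> sat p (DiaIn c (fff A))
    & x \in vars (target r) -> sat p (psi x)].
Proof.
split=> [/sat_conj_seq sat_x|[sat_pos sat_neg sat_target]].
  split=> [b y ry|c rc|ux]; apply: sat_x; apply/In_cat.
  - left; apply/In_pmap; exists (x, inr b, y); first exact/mem_In.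
    by rewrite eqxx.
  - right; apply/In_cat; left; apply/In_pmap; exists (x, inl c); first exact/mem_In.
    by rewrite eqxx.
  - by right; apply/In_cat; right; apply/In_target_conjunct.
apply/sat_conj_seq=> phi /In_cat[/In_pmap[]|/In_cat[/In_pmap[]|]].
- move=> [[z [//|b]] y] /mem_In ry; case: eqP => // zx [<-].
  by apply: sat_pos; rewrite -zx.
- move=> [z [c|//]] /mem_In rc; case: eqP => // zx [<-].
  by apply: sat_neg; rewrite -zx.
- by case/In_target_conjunct=> ux <-; apply: sat_target.
Qed.

End Satisfaction.

(** * Ruloids: premises, targets and the transitions they derive *)

Section Ruloids.

Variables (A : actions) (Sg : signature) (P : gsos_language A Sg).

Lemma In_ruloids_for t a r :
  List.In r (ruloids_for P t a) <-> List.In r (ruloids P t) /\ act r = a.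
Proof. by split=> [/In_filter[? /eqP]|[tr /eqP ra]]; last exact/In_filter. Qed.

Lemma In_ruloids_Var x r :
  List.In r (ruloids P (Var x)) <->
  exists a, r = Rule [:: (x, a, fresh (Var x : term Sg var) 0)] [::] a
                  (Var (fresh (Var x : term Sg var) 0)).
Proof.
split=> [/In_map[a _ <-]|[a ->]]; first by exists a.
by apply/In_map; exists a => //; apply/mem_In; rewrite mem_enum.
Qed.

Lemma In_ruloids_App (f : op Sg) (zs : 'I_(arity f) -> var) r :
  List.In r (ruloids P (App (fun i => Var (zs i)))) <->
  exists2 r0, List.In r0 (rules P f) &
    r = instantiate zs (fresh (App (fun i => Var (zs i)))) r0.
Proof.
rewrite /ruloids (_ : flat _); last by apply/flat_App; exists zs.
by split=> [/In_map[r0 Pr0 <-]|[r0 Pr0 ->]]; [|apply/In_map]; exists r0.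
Qed.

Section Instantiate.

Variables (f : op Sg) (zs : 'I_(arity f) -> var) (ys : nat -> var).
Variable r : gsos_rule A f.

Lemma mem_pos_instantiate x a y :
  (x, a, y) \in pos (instantiate zs ys r) <->
  exists i z, [/\ (i, a, z) \in pos r, x = zs i & y = ys z].
Proof.
split=> [/mapP[[[i b] z] rz [-> -> ->]]|[i [z [rz -> ->]]]]; first by exists i, z.
by apply/mapP; exists (i, a, z).
Qed.

Lemma mem_neg_instantiate x a :
  (x, a) \in neg (instantiate zs ys r) <-> exists2 i, (i, a) \in neg r & x = zs i.
Proof.
split=> [/mapP[[i b] ri [-> ->]]|[i ri ->]]; first by exists i.
by apply/mapP; exists (i, a).
Qed.

Lemma mem_vars_instantiate x :
  x \in vars (target (instantiate zs ys r)) ->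
  (exists i, x = zs i) \/ (exists2 y, inr y \in vars (target r) & x = ys y).
Proof.
case/mem_vars_subst=> -[i|y] uv; rewrite inE => /eqP->; first by left; exists i.
by right; exists y.
Qed.

End Instantiate.

Lemma mem_vars_zs (f : op Sg) (zs : 'I_(arity f) -> var) i :
  zs i \in vars (App (fun i => Var (zs i)) : term Sg var).
Proof. by apply/mem_vars_App; exists i; rewrite inE. Qed.

(** Allows [tau] to be replaced by [sigma] on the left of premises, as the two agree only on
    [vars t]. *)
Lemma ruloid_pos_source t r x a y : flat t -> List.In r (ruloids P t) ->
  (x, a, y) \in pos r -> x \in vars t.
Proof.
case: t => [z _ /In_ruloids_Var[b ->]|f ts /flat_App[zs ->] /In_ruloids_App[r0 _ ->]].
  by rewrite !inE => /eqP[-> _ _].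
by case/mem_pos_instantiate=> i [z [_ -> _]]; apply: mem_vars_zs.
Qed.

Lemma ruloid_neg_source t r x a : flat t -> List.In r (ruloids P t) ->
  (x, a) \in neg r -> x \in vars t.
Proof.
case: t => [z _ /In_ruloids_Var[b ->]|f ts /flat_App[zs ->] /In_ruloids_App[r0 _ ->]] //.
by case/mem_neg_instantiate=> i _ ->; apply: mem_vars_zs.
Qed.

Lemma ruloid_pos_fresh t r x a y : flat t -> List.In r (ruloids P t) ->
  (x, a, y) \in pos r -> y \notin vars t.
Proof.
case: t => [z _ /In_ruloids_Var[b ->]|f ts /flat_App[zs ->] /In_ruloids_App[r0 _ ->]].
  by rewrite inE => /eqP[_ _ ->]; apply: fresh_notin.
by case/mem_pos_instantiate=> i [z [_ _ ->]]; apply: fresh_notin.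
Qed.

Lemma ruloid_pos_uniq t r : flat t -> List.In r (ruloids P t) ->
  uniq [seq p.2 | p <- pos r].
Proof.
case: t => [z _ /In_ruloids_Var[b ->] //|].
move=> f ts /flat_App[zs ->] /In_ruloids_App[r0 Pr0 ->] /=.
set t : term Sg var := App _.
have -> : [seq p.2 | p <- [seq (zs p.1.1, p.1.2, fresh t p.2) | p <- pos r0]] =
    map (fresh t) [seq p.2 | p <- pos r0] by rewrite -!map_comp.
by rewrite (map_inj_uniq (@fresh_inj _ _)); case: (rules_wf Pr0).
Qed.

Lemma ruloid_target_vars t r y : flat t -> List.In r (ruloids P t) ->
  y \in vars (target r) -> y \in vars t \/ exists x a, (x, a, y) \in pos r.
Proof.
case: t => [z _ /In_ruloids_Var[b ->]|f ts /flat_App[zs ->] /In_ruloids_App[r0 Pr0 ->]].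
  by rewrite inE => /eqP->; right; exists z, b; rewrite inE.
case/mem_vars_instantiate=> [[i ->]|[z uz ->]]; first by left; apply: mem_vars_zs.
have [_ /(_ _ uz)/mapP[[[i a] z'] r0z /= zE]] := rules_wf Pr0.
right; exists (zs i), a; apply/mem_pos_instantiate.
by exists i, z'; rewrite zE.
Qed.

(** Keeps the induction on formulae inside flat terms: instantiating a rule sends variables to
    variables. *)
Lemma ruloid_target_flat t r :
  (forall f (r0 : gsos_rule A f), List.In r0 (rules P f) -> flat (target r0)) ->
  flat t -> List.In r (ruloids P t) -> flat (target r).
Proof.
move=> Pflat; case: t => [z _ /In_ruloids_Var[b ->] //|].
move=> f ts /flat_App[zs ->] /In_ruloids_App[r0 Pr0 ->].
by apply: flat_subst (Pflat _ _ Pr0) => -[i|y]; eexists.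
Qed.

Lemma ruloid_input_premises t r : iocos_format P -> flat t ->
    List.In r (ruloids P t) -> is_input (act r) ->
  (forall x b y, (x, b, y) \in pos r -> is_input b) /\
  (forall x b, (x, b) \in neg r -> is_output b).
Proof.
case=> Pin _ _.
case: t => [z _ /In_ruloids_Var[b ->]|f ts /flat_App[zs ->] /In_ruloids_App[r0 Pr0 ->]].
  by move=> ina; split=> // x c y; rewrite inE => /eqP[_ -> _].
move=> /(Pin _ _ Pr0)[Nout pos_in]; split=> x b.
  by move=> y /mem_pos_instantiate[i [z [/pos_in]]].
by case/mem_neg_instantiate=> i /Nout.
Qed.

Lemma ruloid_output_premises t r : iocos_format P -> flat t ->
    List.In r (ruloids P t) -> is_output (act r) ->
  (forall x b y, (x, b, y) \in pos r -> is_output b) /\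
  (forall x b, (x, b) \in neg r -> is_input b).
Proof.
case=> _ _ Pout.
case: t => [z _ /In_ruloids_Var[b ->]|f ts /flat_App[zs ->] /In_ruloids_App[r0 Pr0 ->]].
  by move=> outa; split=> // x c y; rewrite inE => /eqP[_ -> _].
move=> /(Pout _ _ Pr0)[Nin pos_out]; split=> x b.
  by move=> y /mem_pos_instantiate[i [z [/pos_out]]].
by case/mem_neg_instantiate=> i /Nin.
Qed.

(** Inclusion of triggers keeps the label of a premise but not its right-hand variable, hence [y0].
    The last clause covers all labels because an input-emitting rule has only input labels in
    positive premises. *)
Lemma ruloid_input_mixing t a r r' : iocos_format P -> flat t ->
    List.In r (ruloids_for P t (inl a)) -> List.In r' (ruloids_for P t (inl a)) ->
  exists r'', [/\ List.In r'' (ruloids_for P t (inl a)), target r'' = target r',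
    forall x b y, (x, b, y) \in pos r'' -> exists y0, (x, b, y0) \in pos r,
    forall x b, (x, b) \in neg r'' -> (x, b) \in neg r
  & forall x b y, (x, b, y) \in pos r'' -> y \in vars (target r') ->
      (x, b, y) \in pos r'].
Proof.
move=> hP flat_t /In_ruloids_for[tr ra] /In_ruloids_for[tr' ra'].
case: t flat_t tr tr' => [z _|f ts /flat_App[zs ->]].
  case/In_ruloids_Var=> b rE; case/In_ruloids_Var=> b' rE'.
  (* A variable has exactly one ruloid for each label. *)
  have eq_r: r' = r by move: ra ra'; rewrite rE rE' /= => -> ->.
  rewrite eq_r; exists r; split=> //; last by move=> x c y; exists y.
  by apply/In_ruloids_for; split=> //; apply/In_ruloids_Var; exists b.
case/In_ruloids_App=> r0 Pr0 rE; case/In_ruloids_App=> r0' Pr0' rE'.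
rewrite {}rE in ra *; rewrite {}rE' in ra' *.
have [_ Pmix _] := hP; have := Pmix a f _ _ Pr0 ra Pr0' ra'.
case=> r1 [[Pr1 r1a r1u] sub_pos sub_neg pos_r1].
exists (instantiate zs (fresh (App (fun i => Var (zs i)))) r1); split.
- by apply/In_ruloids_for; split=> //; apply/In_ruloids_App; exists r1.
- by rewrite /= r1u.
- move=> x b y /mem_pos_instantiate[i [z [r1z -> _]]].
  have /(subsetP (sub_pos i)) : b \in pos_trigger r1 i.
    by rewrite inE; apply/mapP; exists (i, b, z).
  rewrite inE => /mapP[[[j c] y0] r0y0 [-> ->]].
  exists (fresh (App (fun i => Var (zs i))) y0).
  by apply/mem_pos_instantiate; exists j, y0.
- move=> x b /mem_neg_instantiate[i r1i ->].
  have /(subsetP (sub_neg i)) : b \in neg_trigger r1 i by rewrite inE.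
  by rewrite inE => r0i; apply/mem_neg_instantiate; exists i.
- move=> x b y ry; have [i [z [r1z -> ->]]] := (mem_pos_instantiate _ _ _ _ _ _).1 ry.
  (* A fresh variable is never an argument, and [fresh] is injective, so the occurrence in the
     target comes from the same variable of [r0']. *)
  case/mem_vars_instantiate=> [[j fresh_zs]|[z' uz' /fresh_inj zz']].
    by have := fresh_notin (App (fun i => Var (zs i))) z; rewrite fresh_zs mem_vars_zs.
  rewrite -{}zz' in uz'; apply/mem_pos_instantiate; exists i, z; split=> //.
  case: b r1z {ry} => [b|b] r1z; first exact: pos_r1.
  have [Pin _ _] := hP; have [_ pos_in] := Pin _ _ Pr1 (etrans (congr1 _ r1a) erefl).
  by have := pos_in _ _ _ r1z.
Qed.

Variable S : lts A.

(** A single [tau] values source variables and right-hand variables alike; in a ruloid of [t],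
    freshness keeps the two roles apart. *)
Definition enables (r : ruloid A Sg) (tau : var -> term Sg (state S)) : Prop :=
  (forall x b y, (x, b, y) \in pos r -> step P (tau x) b (tau y)) /\
  (forall x b, (x, b) \in neg r -> forall q, ~ step P (tau x) b q).

(** The clause of [step] for [App] has separate functions for arguments and successors. As fresh
    variables avoid [t], both fit into one [tau], and composing [tau] with [fresh t] recovers the
    second. *)
Lemma step_ruloid t sigma a p : flat t ->
  step P (subst sigma t) a p <->
  exists r tau, [/\ List.In r (ruloids_for P t a), {in vars t, tau =1 sigma},
    enables r tau & p = subst tau (target r)].
Proof.
case: t => [x _|f ts /flat_App[zs ->]].
  set t : term Sg var := Var x; split=> [st_p|[r [tau [/In_ruloids_for[]]]]].
    exists (Rule [:: (x, a, fresh t 0)] [::] a (Var (fresh t 0))).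
    pose tau v := if v \in vars t then sigma v else p.
    have tau_x : tau x = sigma x by rewrite /tau inE eqxx.
    have tau_fresh : tau (fresh t 0) = p by rewrite /tau (negPf (fresh_notin _ _)).
    exists tau; split=> //.
    - by apply/In_ruloids_for; split=> //; apply/In_ruloids_Var; exists a.
    - by move=> v tv; rewrite /tau tv.
    - by split=> // z b y /[!inE] /eqP[-> -> ->]; rewrite tau_x tau_fresh.
  case/In_ruloids_Var=> b -> /= -> tauE [en _] ->.
  by rewrite -tauE ?inE //; apply: en; rewrite inE.
set t : term Sg var := App _; split.
  case=> r [q [[Pr ra] en_pos en_neg ->]].
  (* Subtracting one more than the maximum inverts [fresh t]; values at the remaining variables are
     arbitrary. *)
  pose tau v := if v \in vars t then sigma v else q (v - (\max_(x <- vars t) x).+1).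
  have tau_zs i : tau (zs i) = sigma (zs i) by rewrite /tau mem_vars_zs.
  have tau_fresh y : tau (fresh t y) = q y.
    by rewrite /tau (negPf (fresh_notin _ _)) addKn.
  exists (instantiate zs (fresh t) r), tau; split.
  - by apply/In_ruloids_for; split=> //; apply/In_ruloids_App; exists r.
  - by move=> v tv; rewrite /tau tv.
  - split=> [x b y|x b].
      case/mem_pos_instantiate=> i [z [rz -> ->]].
      by rewrite tau_zs tau_fresh; apply: en_pos.
    by case/mem_neg_instantiate=> i ri -> q0; rewrite tau_zs; apply: en_neg.
  - rewrite /= subst_subst; congr subst; apply: functional_extensionality.
    by case=> [i|y] /=; rewrite ?tau_zs ?tau_fresh.
case=> r [tau [/In_ruloids_for[/In_ruloids_App[r0 Pr0 ->] ra] tauE [en_pos en_neg] ->]].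
exists r0, (tau \o fresh t); split=> //.
- move=> i b y r0y; rewrite /= -tauE ?mem_vars_zs //.
  by apply: en_pos; apply/mem_pos_instantiate; exists i, y.
- move=> i b r0i q; rewrite /= -tauE ?mem_vars_zs //.
  by apply: en_neg; apply/mem_neg_instantiate; exists i.
- rewrite /= subst_subst; congr subst; apply: functional_extensionality.
  by case=> [i|y] //=; rewrite tauE ?mem_vars_zs.
Qed.

(** Premises can be witnessed one by one, since each fresh variable is the right-hand side of at
    most one of them. [Q] records what the chosen successors should satisfy. *)
Lemma extend_subst t r sigma (Q : var -> term Sg (state S) -> Prop) : flat t ->
    List.In r (ruloids P t) ->
    (forall x b y, (x, b, y) \in pos r -> exists2 p, step P (sigma x) b p & Q y p) ->
    (forall x b, (x, b) \in neg r -> forall q, ~ step P (sigma x) b q) ->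
  exists tau, [/\ {in vars t, tau =1 sigma}, enables r tau
    & forall x b y, (x, b, y) \in pos r -> Q y (tau y)].
Proof.
move=> flat_t tr en_pos en_neg.
(* Choice needs a value at every variable: a witness at right-hand variables, [sigma y] at the
   others. *)
have [|tau tauP] := functional_choice (fun y p =>
    (y \in vars t -> p = sigma y) /\
    forall x b, (x, b, y) \in pos r -> step P (sigma x) b p /\ Q y p).
  move=> y; have [[x [b ry]]|Nr] := classic (exists x b, (x, b, y) \in pos r).
    have [p st_p Qp] := en_pos _ _ _ ry; exists p; split.
      by rewrite (negPf (ruloid_pos_fresh flat_t tr ry)).
    move=> x' b' ry'.
    (* Two premises with the same right-hand variable coincide, so one witness serves. *)
    by case: (uniq_map_inj (ruloid_pos_uniq flat_t tr) ry ry' erefl) => <- <-.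
  by exists (sigma y); split=> // x b ry; case: Nr; exists x, b.
have tauE : {in vars t, tau =1 sigma} by move=> x; case: (tauP x).
exists tau; split=> //; last by move=> x b y /(proj2 (tauP y))[].
split=> x b => [y ry|rb q]; rewrite tauE.
- by case: (proj2 (tauP y) _ _ ry).
- exact: ruloid_pos_source ry.
- exact: en_neg.
- exact: ruloid_neg_source rb.
Qed.

End Ruloids.

(** * Correctness of the decomposition, one connective at a time *)

Section Decomposition.

Variables (A : actions) (Sg : signature) (P : gsos_language A Sg) (S : lts A).
Hypothesis P_iocos : iocos_format P.
Hypothesis P_flat : forall f (r : gsos_rule A f),
  List.In r (rules P f) -> flat (target r).

Local Notation proc := (term Sg (state S)).
Local Notation "p |= phi" := (@sat A (induced P S) p phi) (at level 70).

(** Quantified over [t] and [sigma] because the induction hypothesis is applied to the target of a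
    ruloid and to an extended substitution. *)
Definition decomposable (phi : formula A) : Prop :=
  forall (t : term Sg var) (sigma : var -> proc), flat t ->
  subst sigma t |= phi <->
  exists psi, decomp P phi t psi /\ {in vars t, forall x, sigma x |= psi x}.

(** A positive premise fails only if there is no transition at all, since its right-hand variable is
    still free to take any value. *)
Definition refutes (sigma : var -> proc) (g : premise A) : Prop :=
  match g with
  | inl (x, b, _) => forall q, ~ step P (sigma x) b q
  | inr (x, b) => exists q, step P (sigma x) b q
  end.

Definition lhs (g : premise A) : var :=
  match g with inl (x, _, _) => x | inr (x, _) => x end.

(** Premises outside the input format are negated to [fff] at their left-hand variable, and [fff]
    holds nowhere. *)
Lemma sat_negate_refutes sigma g :
  sigma (lhs g) |= negate g (lhs g) -> refutes sigma g.
Proof.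
case: g => [[[x [b|b]] y]|[x [b|b]]] /=; rewrite eqxx.
- by move/sat_DiaIn_fff.
- by move/not_sat_fff.
- by move/not_sat_fff.
- by move/sat_DiaOut_ftt.
Qed.

(** The input format leaves the two cases where [negate] expresses failure exactly; at variables
    other than the left-hand one it is [ftt]. *)
Lemma refutes_sat_negate t r sigma g x : flat t -> List.In r (ruloids P t) ->
    is_input (act r) -> in_premises r g -> refutes sigma g ->
  sigma x |= negate g x.
Proof.
move=> flat_t tr ina; have [pos_in neg_out] := ruloid_input_premises P_iocos flat_t tr ina.
case: g => [[[z b] y]|[z b]] /=.
  move=> /pos_in; case: b => // b _ Nst; case: eqP => [<-|_]; last exact: sat_ftt.
  exact/sat_DiaIn_fff.
move=> /neg_out; case: b => // b _ st; case: eqP => [<-|_]; last exact: sat_ftt.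
exact/sat_DiaOut_ftt.
Qed.

(** When no premise fails, classical logic supplies a successor for each positive premise, and
    [extend_subst] combines them. *)
Lemma not_refuted_step t r sigma : flat t -> List.In r (ruloids P t) ->
    (forall g, in_premises r g -> ~ refutes sigma g) ->
  exists q, step P (subst sigma t) (act r) q.
Proof.
move=> flat_t tr Nref.
have [||||tau [tauE en _]] := @extend_subst _ _ P S t r sigma (fun _ _ => True) => //.
- move=> x b y ry; apply: NNPP => Nst; case: (Nref (inl (x, b, y)) ry) => q st.
  by apply: Nst; exists q.
- by move=> x b rb q st; apply: (Nref (inr (x, b)) rb); exists q.
exists (subst tau (target r)); apply/step_ruloid => //.
by exists r, tau; split=> //; apply/In_ruloids_for.
Qed.

(** In the converse direction, the premise that [eta] picks from a firing ruloid would both hold and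
    fail. *)
Lemma decomp_chiP t a sigma : flat t ->
  (forall q, ~ step P (subst sigma t) (inl a) q) <->
  exists psi, decomp_chi P t a psi /\ {in vars t, forall x, sigma x |= psi x}.
Proof.
move=> flat_t; split.
  move=> Nst; have [|eta etaP] := functional_choice (fun r g =>
      List.In r (ruloids_for P t (inl a)) -> in_premises r g /\ refutes sigma g).
    move=> r; have [tr|Ntr] := classic (List.In r (ruloids_for P t (inl a))).
      case/In_ruloids_for: tr => tr ra; apply: NNPP => Nref.
      have [|q] := @not_refuted_step t r sigma flat_t tr.
        by move=> g rg ref_g; apply: Nref; exists g.
      by rewrite ra; apply: Nst.
    (* A dummy value outside [ruloids_for], where [eta] is unconstrained. *)
    by exists (inl (0, inl a, 0)).
  exists (fun x => conj_seq [seq negate (eta r) x | r <- ruloids_for P t (inl a)]).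
  split; first by exists eta => // r /etaP[].
  move=> x tx; apply/sat_conj_seq=> phi /In_map[r tr <-].
  have [r_eta ref_eta] := etaP r tr; case/In_ruloids_for: tr => tr ra.
  by apply: (refutes_sat_negate _ flat_t tr _ r_eta ref_eta); rewrite ra.
case=> psi [[eta chi_eta psiE] sat_psi] q /(step_ruloid _ _ _ _ flat_t).
case=> r [tau [tr tauE [en_pos en_neg] _]].
have r_eta := chi_eta r tr; have [tr0 _] := (In_ruloids_for _ _ _ _).1 tr.
(* [psi] is known to hold only at variables of [t], so the chosen premise must test one of them. *)
have t_eta : lhs (eta r) \in vars t.
  case: (eta r) r_eta => [[[x b] y]|[x b]] /= rx.
    exact: ruloid_pos_source flat_t tr0 rx.
  exact: ruloid_neg_source flat_t tr0 rx.
have : refutes sigma (eta r).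
  apply: sat_negate_refutes; move: (sat_psi _ t_eta); rewrite psiE.
  by move/sat_conj_seq; apply; apply/In_map; exists r.
case: (eta r) r_eta t_eta => [[[x b] y]|[x b]] /= rx tx; rewrite -tauE //.
  by move/(_ _ (en_pos _ _ _ rx)).
by case=> q0; apply: en_neg.
Qed.

Lemma decomp_DiaIn a phi : decomposable phi -> decomposable (DiaIn a phi).
Proof.
move=> IHphi t sigma flat_t; split.
  case=> [/(decomp_chiP _ _ flat_t)[psi [chi_psi sat_psi]]|[p]].
    by exists psi; split=> //; left.
  case/(step_ruloid _ _ _ _ flat_t)=> r [tau [tr tauE [en_pos en_neg] ->]].
  have [tr0 _] := (In_ruloids_for _ _ _ _).1 tr.
  case/(IHphi _ _ (ruloid_target_flat P_flat flat_t tr0))=> psi' [dec_psi' sat_psi'].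
  exists (pull_in r psi'); split; first by right; exists r, psi'.
  move=> x tx; apply/sat_pull_in; rewrite -tauE //; split=> [b y ry uy|]; last exact: sat_psi'.
  by right; exists (tau y); [apply: en_pos|apply: sat_psi'].
case=> psi [[chi_psi|[r' [psi' [tr' dec_psi' psiE]]]] sat_psi].
  by left; apply/(decomp_chiP _ _ flat_t); exists psi.
(* Without an input transition the modality holds at once, so some ruloid [r] may be assumed to
   fire. *)
have [[q]|Nst] := classic (exists q, step P (subst sigma t) (inl a) q); last first.
  by left=> q st; apply: Nst; exists q.
case/(step_ruloid _ _ _ _ flat_t)=> r [tau [tr tauE [en_pos en_neg] _]].
have [tr0 _] := (In_ruloids_for _ _ _ _).1 tr.
have [tr0' _] := (In_ruloids_for _ _ _ _).1 tr'.
have [r'' [tr'' r''u pos_r'' neg_r'' mem_r']] := ruloid_input_mixing P_iocos flat_t tr tr'.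
have [tr0'' r''a] := (In_ruloids_for _ _ _ _).1 tr''.
have [||||tau'' [tau''E en'' sat_tau'']] := @extend_subst _ _ P S t r'' sigma
    (fun y p => y \in vars (target r') -> p |= psi' y) => //.
- move=> x b y r''y; have tx := ruloid_pos_source flat_t tr0'' r''y.
  have [y0 /en_pos] := pos_r'' _ _ _ r''y; rewrite tauE // => st.
  (* If [y] is absent from the target, the successor that [r] provides for the same label suffices;
     otherwise the premise also belongs to [r'], and [psi] speaks of it. *)
  have [uy|Nuy] := boolP (y \in vars (target r')); last by exists (tau y0).
  have [|pos_in _] := ruloid_input_premises P_iocos flat_t tr0''; first by rewrite r''a.
  have := mem_r' _ _ _ r''y uy.
  case: b st r''y => [b|b] st r''y r'y; last by have := pos_in _ _ _ r''y.
  have := sat_psi x tx; rewrite psiE => /sat_pull_in[/(_ _ _ r'y uy)].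
  (* The transition [st] rules out refusal, which leaves a successor satisfying [psi' y]. *)
  by case=> [/(_ _ st) //|[p st_p sat_p] _]; exists p.
- move=> x b /neg_r'' rb q0; rewrite -tauE; first exact: en_neg.
  exact: ruloid_neg_source flat_t tr0 rb.
right; exists (subst tau'' (target r'')).
  by apply/(step_ruloid _ _ _ _ flat_t); exists r'', tau''.
rewrite r''u; apply/(IHphi _ _ (ruloid_target_flat P_flat flat_t tr0')).
exists psi'; split=> // y uy; have uy'' := uy; rewrite -r''u in uy''.
(* Source variables are covered by the target conjunct of [pull_in], fresh ones by the choice of
   [tau'']. *)
have [ty|[x [b r''y]]] := ruloid_target_vars flat_t tr0'' uy''.
  by rewrite tau''E //; have := sat_psi y ty; rewrite psiE => /sat_pull_in[_]; apply.
exact: sat_tau'' r''y uy.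
Qed.

(** Here [psi] itself makes the ruloid [r] fire: [DiaOut] demands a transition for each positive
    premise, and [DiaIn c (fff A)] its absence for each negative one. The output format ensures that
    [pull_out] drops no premise. *)
Lemma decomp_DiaOut a phi : decomposable phi -> decomposable (DiaOut a phi).
Proof.
move=> IHphi t sigma flat_t; split.
  case=> p /(step_ruloid _ _ _ _ flat_t)[r [tau [tr tauE [en_pos en_neg] ->]]].
  have [tr0 _] := (In_ruloids_for _ _ _ _).1 tr.
  case/(IHphi _ _ (ruloid_target_flat P_flat flat_t tr0))=> psi' [dec_psi' sat_psi'].
  exists (pull_out r psi'); split; first by exists r, psi'.
  move=> x tx; apply/sat_pull_out; rewrite -tauE //.
  split=> [b y ry|c rc|]; last exact: sat_psi'.
    exists (tau y); first exact: en_pos.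
    by case: ifP => [|_]; [apply: sat_psi'|apply: sat_ftt].
  by apply/sat_DiaIn_fff; apply: en_neg.
case=> psi [[r [psi' [tr dec_psi' psiE]]] sat_psi].
have [tr0 ra] := (In_ruloids_for _ _ _ _).1 tr.
have [|pos_out neg_in] := ruloid_output_premises P_iocos flat_t tr0; first by rewrite ra.
have [||||tau [tauE en sat_tau]] := @extend_subst _ _ P S t r sigma
    (fun y p => y \in vars (target r) -> p |= psi' y) => //.
- move=> x b y ry; have tx := ruloid_pos_source flat_t tr0 ry.
  case: b ry (pos_out _ _ _ ry) => // b ry _.
  have := sat_psi x tx; rewrite psiE => /sat_pull_out[/(_ _ _ ry)[p st sat_p] _ _].
  by exists p => // uy; rewrite uy in sat_p.
- move=> x c rc; have tx := ruloid_neg_source flat_t tr0 rc.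
  case: c rc (neg_in _ _ rc) => // c rc _.
  by have := sat_psi x tx; rewrite psiE => /sat_pull_out[_ /(_ _ rc)/sat_DiaIn_fff].
exists (subst tau (target r)); first by apply/(step_ruloid _ _ _ _ flat_t); exists r, tau.
apply/(IHphi _ _ (ruloid_target_flat P_flat flat_t tr0)).
exists psi'; split=> // y uy.
have [ty|[x [b ry]]] := ruloid_target_vars flat_t tr0 uy; last exact: sat_tau ry uy.
by rewrite tauE //; have := sat_psi y ty; rewrite psiE => /sat_pull_out[_ _]; apply.
Qed.

Lemma decomp_Conj n (F : 'I_n -> formula A) :
  (forall i, decomposable (F i)) -> decomposable (Conj F).
Proof.
move=> IHF t sigma flat_t; split=> [sat_F|[psi [[Psi dec_Psi psiE] sat_psi]] i].
  (* The index set is finite, so the maps [Psi i] are collected without an axiom of choice. *)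
  have /fin_all_exists[Psi PsiP] :=
    fun i => (IHF i t sigma flat_t).1 (sat_F i).
  exists (fun x => Conj (fun i => Psi i x)); split.
    by exists Psi => // i; have [] := PsiP i.
  by move=> x tx i; have [_] := PsiP i; apply.
apply/(IHF i t sigma flat_t); exists (Psi i); split=> [|x tx]; first exact: dec_Psi.
by have := sat_psi x tx; rewrite psiE.
Qed.

Lemma decomp_Disj n (F : 'I_n -> formula A) :
  (forall i, decomposable (F i)) -> decomposable (Disj F).
Proof.
move=> IHF t sigma flat_t; split.
  case=> i /(IHF i t sigma flat_t)[psi [dec_psi sat_psi]].
  by exists psi; split=> //; exists i.
case=> psi [[i dec_psi] sat_psi].
by exists i; apply/(IHF i t sigma flat_t); exists psi.
Qed.

Lemma decompP phi : decomposable phi.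
Proof.
elim: phi => [a phi|a phi|n F|n F].
- exact: decomp_DiaIn.
- exact: decomp_DiaOut.
- exact: decomp_Conj.
- exact: decomp_Disj.
Qed.

End Decomposition.

Theorem theorem6 (A : actions) (Sg : signature) (P : gsos_language A Sg)
    (S : lts A)
    (hP : iocos_format P)
    (hflat : forall (f : op Sg) (r : gsos_rule A f),
       List.In r (rules P f) -> flat (target r))
    (t : term Sg var) (ht : flat t) (phi : formula A)
    (sigma : var -> term Sg (state S)) :
  @sat A (induced P S) (subst sigma t) phi <->
  exists psi : var -> formula A,
    decomp P phi t psi /\
    forall x : var, x \in vars t -> @sat A (induced P S) (sigma x) (psi x).
Proof. exact: (decompP hP hflat phi sigma ht). Qed.
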